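(* Let $n\ge1$, let $\varphi:\mathbb{R}^n\to\mathbb{R}$ be an admissible payoff function, and let $\tilde\varphi=\varphi*\eta$ be its mollification. For every $0<\varepsilon<1$ the equation $\mathcal{F}_\varepsilon[u]=0$ on $\mathbb{R}^n$, where $$\mathcal{F}_\varepsilon[u](x)=u(x)-\varphi(x)-\frac{1-\varepsilon^2}{\varepsilon^2}\min_{player}\max_{market}\mathbf{E}[u(x+\varepsilon\Delta x)-u(x)],$$ has a unique solution $u_\varepsilon$ in the class of functions $u:\mathbb{R}^n\to\mathbb{R}$ such that $u-\tilde\varphi$ is uniformly bounded on $\mathbb{R}^n$. Moreover $u_\varepsilon$ has the following properties: 1. There is a constant $M$, independent of $\varepsilon$, such that $|u_\varepsilon(x)-\tilde\varphi(x)|\le M$ for all $x\in\mathbb{R}^n$. 2. $u_\varepsilon$ is monotone nondecreasing in each variable $x_j$. 3. $u_\varepsilon(x_1+c,x_2+c,\dots,x_n+c)=u_\varepsilon(x_1,x_2,\dots,x_n)+c$ for all $x\in\mathbb{R}^n$ and $c\in\mathbb{R}$.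
   Context: Admissible payoff: $\varphi:\mathbb{R}^n\to\mathbb{R}$ is globally Lipschitz continuous, non-decreasing in each variable, symmetric in $x_1,\dots,x_n$, satisfies $|\varphi(x)|\le C_1|x|+C_2$ for some constants, and satisfies $\varphi(x_1+c,\dots,x_n+c)=\varphi(x_1,\dots,x_n)+c$ for all $c\in\mathbb{R}$. Mollification: $\tilde\varphi=\varphi*\eta$ with $\eta(x)=c_\eta e^{-1/(1-|x|^2)}$ for $|x|<1$ and $\eta(x)=0$ for $|x|\ge1$, where $c_\eta$ is chosen so that $\int\eta=1$. Game operators: $\min_{player}$ is the minimum over probability vectors $\alpha=(\alpha_1,\dots,\alpha_n)$ ($\alpha_k\ge0$, $\sum_k\alpha_k=1$); $\max_{market}$ is the maximum over probability distributions $p$ on $\{0,1\}^n$. For given $\alpha,p$, $$\mathbf{E}[u(x+\varepsilon\Delta x)-u(x)]=\sum_{k=1}^n\alpha_k\sum_{v\in\{0,1\}^n}p(v)\,\big[u\big(x+\varepsilon(v-v_k\vec 1)\big)-u(x)\big],\qquad \vec 1=(1,\dots,1).$$ The equation $\mathcal{F}_\varepsilon[u]=0$ is equivalent to $u(x)=\varepsilon^2\varphi(x)+(1-\varepsilon^2)\min_{player}\max_{market}\mathbf{E}[u(x+\varepsilon\Delta x)]$. *)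

(* Defs.v *)
From HB Require Import structures.
From mathcomp Require Import all_boot all_order all_fingroup all_algebra.
From mathcomp Require Import all_classical all_reals all_analysis.

Set Implicit Arguments.
Unset Strict Implicit.
Unset Printing Implicit Defensive.

Import Order.TTheory GRing.Theory Num.Theory.
Import numFieldNormedType.Exports.

Local Open Scope classical_set_scope.
Local Open Scope ring_scope.

(* The library puts the product sigma-algebra on n.-tuple T but no measure; the
   n-fold product of a measure m is built here by recursion on n, transporting
   m \x m^n along the bijection (a, t) |-> a :: t. *)

Definition cons_pair (T : Type) (n : nat) (p : T * n.-tuple T) :
  n.+1.-tuple T := [the n.+1.-tuple T of p.1 :: p.2].

Lemma measurable_cons_pair d (T : measurableType d) (n : nat) :
  measurable_fun [set: T * n.-tuple T] (@cons_pair T n).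
Proof. by apply: measurable_cons. Qed.

Definition cons_measure d (T : measurableType d) (R : realType) (n : nat)
    (m : set T -> \bar R) (nu : set (n.-tuple T) -> \bar R) :
    set (n.+1.-tuple T) -> \bar R :=
  pushforward (m \x nu)%E (@cons_pair T n).

Section cons_measure_instances.
Local Open Scope ereal_scope.
Context d (T : measurableType d) (R : realType) (n : nat).
Variable m : {sigma_finite_measure set T -> \bar R}.
Variable nu : {sigma_finite_measure set (n.-tuple T) -> \bar R}.

Let measurable_preimage (A : set (n.+1.-tuple T)) :
  measurable A -> measurable (@cons_pair T n @^-1` A).
Proof.
by move=> mA; rewrite -[X in measurable X]setTI; exact: measurable_cons_pair.
Qed.

Let cons_measure0 : cons_measure m nu set0 = 0.
Proof. by rewrite /cons_measure /pushforward preimage_set0 measure0. Qed.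

Let cons_measure_ge0 A : 0 <= cons_measure m nu A.
Proof. by rewrite /cons_measure /pushforward; exact: measure_ge0. Qed.

Let cons_measure_sigma_additive : semi_sigma_additive (cons_measure m nu).
Proof.
move=> F mF tF mUF; rewrite /cons_measure /pushforward preimage_bigcup.
apply: measure_semi_sigma_additive.
- by move=> i; exact: measurable_preimage.
- apply/trivIsetP => /= i j _ _ ij; rewrite -preimage_setI.
  by move/trivIsetP : tF => /(_ _ _ _ _ ij) ->//; rewrite preimage_set0.
- by rewrite -preimage_bigcup; exact: measurable_preimage.
Qed.

HB.instance Definition _ := isMeasure.Build _ _ _ (cons_measure m nu)
  cons_measure0 cons_measure_ge0 cons_measure_sigma_additive.

Let cons_measure_sigma_finite : sigma_finite setT (cons_measure m nu).
Proof.
have [F TF Foo] : sigma_finite setT (m \x nu).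
  have /sigma_finiteP[A [TA ndA Aoo]] := sigma_finiteT m.
  have /sigma_finiteP[B [TB ndB Boo]] := sigma_finiteT nu.
  exists (fun k => A k `*` B k).
    rewrite -setXTT TA TB predeqE => -[x y]; split; last first.
      by move=> [k _ []/= ? ?]; split; exists k.
    move=> [/= [i _ Aix] [j _ Bjy]]; exists (maxn i j) => //; split.
    - by move: x Aix; exact/subsetPset/ndA/leq_maxl.
    - by move: y Bjy; exact/subsetPset/ndB/leq_maxr.
  move=> k; have [mA Ak] := Aoo k; have [mB Bk] := Boo k.
  split; first exact: measurableX.
  by rewrite product_measure1E// lte_mul_pinfty// ge0_fin_numE.
pose uncons (t : n.+1.-tuple T) := (thead t, [tuple of behead t] : n.-tuple T).
have unconsK : cancel uncons (@cons_pair T n).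
  by move=> t; apply/val_inj => /=; case/tupleP: t.
have cons_pairK : cancel (@cons_pair T n) uncons.
  move=> [a t]; rewrite /uncons /cons_pair/=.
  by congr (_, _); apply/val_inj.
have muncons : measurable_fun setT uncons.
  apply: measurable_fun_pair; first exact: (measurable_tnth ord0).
  exact: measurable_behead.
exists (fun k => uncons @^-1` F k).
  by rewrite -preimage_bigcup -TF.
move=> k; have [mFk Fkoo] := Foo k; split.
  by rewrite -[X in measurable X]setTI; exact: muncons.
rewrite /cons_measure /pushforward -comp_preimage.
rewrite (_ : _ \o _ = id); last by apply/funext => p /=; rewrite cons_pairK.
by rewrite preimage_id.
Qed.

HB.instance Definition _ := Measure_isSigmaFinite.Build _ _ _
  (cons_measure m nu) cons_measure_sigma_finite.

End cons_measure_instances.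

Fixpoint tuple_measure d (T : measurableType d) (R : realType)
    (m : {sigma_finite_measure set T -> \bar R}) (n : nat) :
    {sigma_finite_measure set (n.-tuple T) -> \bar R} :=
  match n with
  | 0%N => [the {sigma_finite_measure set _ -> \bar R} of
              \d_([tuple] : 0.-tuple T)]
  | n'.+1 => [the {sigma_finite_measure set _ -> \bar R} of
              cons_measure m (tuple_measure m n')]
  end.

Definition lebesgue_tuple (R : realType) (n : nat) :
    {sigma_finite_measure set (n.-tuple (measurableTypeR R)) -> \bar R} :=
  tuple_measure [the {sigma_finite_measure set _ -> \bar R} of lebesgue_measure] n.

Section setting.
Context (R : realType) (n : nat).
Implicit Types (x y : 'rV[R]_n) (f g u v phi : 'rV[R]_n -> R).

Definition enorm x : R := Num.sqrt (\sum_i x 0 i ^+ 2).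

Definition row_of_tuple (t : n.-tuple (measurableTypeR R)) : 'rV[R]_n :=
  \row_i (tnth t i : R).

(* Row vectors carry no sigma-algebra in the library: R^n is integrated over
   through tuples of coordinates. *)
Definition integral_rV f : R := \int[lebesgue_tuple R n]_t f (row_of_tuple t).

Definition bump x : R :=
  if enorm x < 1 then expR (- (1 - enorm x ^+ 2)^-1) else 0.

Definition mollifier x : R := (integral_rV bump)^-1 * bump x.

Definition convolution f g x : R := integral_rV (fun y => f (x - y) * g y).

Definition mollification phi : 'rV[R]_n -> R := convolution phi mollifier.

Definition nondecreasing_coord f : Prop :=
  forall (j : 'I_n) x y, (forall i, i != j -> x 0 i = y 0 i) ->
    x 0 j <= y 0 j -> f x <= f y.

Definition translation_equivariant f : Prop :=
  forall x (c : R), f (x + const_mx c) = f x + c.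

Definition bounded_difference u v : Prop :=
  exists B : R, forall x, `|u x - v x| <= B.

Record admissible phi : Prop := Admissible {
  admissible_lipschitz :
    exists L : R, forall x y, `|phi x - phi y| <= L * enorm (x - y);
  admissible_nondecreasing : nondecreasing_coord phi;
  admissible_symmetric :
    forall (s : 'S_n) x, phi (\row_i x 0 (s i)) = phi x;
  admissible_growth :
    exists C1 C2 : R, forall x, `|phi x| <= C1 * enorm x + C2;
  admissible_translation : translation_equivariant phi }.

End setting.

Definition is_distribution (R : realType) (I : finType) (p : I -> R) : Prop :=
  (forall i, 0 <= p i) /\ \sum_i p i = 1.

(* Junk value 0 on sets without a minimum (maximum); by max_market_spec and
   game_value_spec below, the extrema of the game are attained when n >= 1. *)
Definition set_min (R : realType) (A : set R) : R := xget 0 (A `&` lbound A).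
Definition set_max (R : realType) (A : set R) : R := xget 0 (A `&` ubound A).

Section game.
Context (R : realType) (n : nat).
Implicit Types (x : 'rV[R]_n) (u phi : 'rV[R]_n -> R) (eps : R).
Implicit Types (alpha : 'I_n -> R) (p : {ffun 'I_n -> bool} -> R).

(* The increment v - v_k (1, ..., 1), for v in {0,1}^n. *)
Definition increment (k : 'I_n) (v : {ffun 'I_n -> bool}) : 'rV[R]_n :=
  \row_j ((v j)%:R - (v k)%:R).

Definition expected_increment eps u x alpha p : R :=
  \sum_k alpha k *
    \sum_v p v * (u (x + eps *: increment k v) - u x).

Definition max_market eps u x alpha : R :=
  set_max [set expected_increment eps u x alpha p | p in @is_distribution R _].

Definition game_value eps u x : R :=
  set_min [set max_market eps u x alpha | alpha in @is_distribution R _].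

Definition game_operator phi eps u x : R :=
  u x - phi x - (1 - eps ^+ 2) / eps ^+ 2 * game_value eps u x.


Let vertex_payoff eps u x alpha v : R :=
  \sum_k alpha k * (u (x + eps *: increment k v) - u x).

Let expected_incrementE eps u x alpha p :
  expected_increment eps u x alpha p =
  \sum_v p v * vertex_payoff eps u x alpha v.
Proof.
rewrite /expected_increment; under eq_bigr do rewrite mulr_sumr.
rewrite exchange_big/=; apply: eq_bigr => v _.
by rewrite mulr_sumr; apply: eq_bigr => k _; rewrite mulrCA.
Qed.

Let max_market_vertex eps u x alpha :
  exists2 p, is_distribution p &
   [/\ max_market eps u x alpha = expected_increment eps u x alpha p,
      forall q, is_distribution q ->
        expected_increment eps u x alpha q <= max_market eps u x alpha &
      max_market eps u x alpha =
        \big[Order.max/vertex_payoff eps u x alpha [ffun=> false]]_v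
          vertex_payoff eps u x alpha v].
Proof.
set c := vertex_payoff eps u x alpha.
have [w _ wmax] := @arg_maxP _ _ _ [ffun=> false] xpredT c isT.
pose p0 (v : {ffun 'I_n -> bool}) : R := (v == w)%:R.
have p0d : is_distribution p0.
  split=> [v|]; first by rewrite ler0n.
  by rewrite (bigD1 w)//= /p0 eqxx big1 ?addr0// => v /negbTE ->.
have Ep0 : expected_increment eps u x alpha p0 = c w.
  rewrite expected_incrementE (bigD1 w)//= /p0 eqxx mul1r.
  by rewrite big1 ?addr0// => v /negbTE ->; rewrite mul0r.
have cub p : is_distribution p -> expected_increment eps u x alpha p <= c w.
  move=> [p_ge0 p1]; rewrite expected_incrementE -[leRHS]mul1r -p1 mulr_suml.
  by apply: ler_sum => v _; apply: ler_wpM2l; [exact: p_ge0|exact: wmax].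
have mw : max_market eps u x alpha = c w.
  rewrite /max_market /set_max; case: xgetP => [m _ [[p pd <-] mub]|/(_ (c w))].
    by apply/le_anti; rewrite cub// -Ep0; apply: mub; exists p0.
  by case; split; [exists p0|move=> _ [p pd <-]; exact: cub].
exists p0 => //; split; [by rewrite mw|by move=> p pd; rewrite mw; exact: cub|].
rewrite mw; apply/le_anti/andP; split; first exact: le_bigmax.
by apply/bigmax_leP; split=> [|v _]; exact: wmax.
Qed.

Lemma max_market_spec eps u x alpha :
  (exists2 p, is_distribution p &
     max_market eps u x alpha = expected_increment eps u x alpha p) /\
  forall p, is_distribution p ->
    expected_increment eps u x alpha p <= max_market eps u x alpha.
Proof.
have [p pd [mE mub _]] := max_market_vertex eps u x alpha.
by split; [exists p|exact: mub].
Qed.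

Lemma game_value_spec eps u x : (1 <= n)%N ->
  (exists2 alpha, is_distribution alpha &
     game_value eps u x = max_market eps u x alpha) /\
  forall alpha, is_distribution alpha ->
    game_value eps u x <= max_market eps u x alpha.
Proof.
move=> n1; pose D (a : 'rV[R]_n) := is_distribution (a 0).
have D0 : [set a | D a] !=set0.
  exists (\row_j (j == Ordinal n1)%:R); split=> [i|]; first by rewrite mxE ler0n.
  rewrite (bigD1 (Ordinal n1))//= mxE eqxx big1 ?addr0// => i /negbTE.
  by rewrite mxE => ->.
have Dcompact : compact [set a | D a].
  have cube : compact [set a : 'rV[R]_n | forall i, `[0, 1]%classic (a 0 i)].
    by apply: (@rV_compact R n (fun=> `[0, 1]%classic)) => i;
      exact: segment_compact.
  apply: subclosed_compact cube _; last first.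
    move=> a [a0 a1] i /=; rewrite in_itv/= a0/= -a1 (bigD1 i)//= lerDl.
    exact: sumr_ge0.
  rewrite (_ : [set a | D a] =
      (\bigcap_(i in [set: 'I_n])
        ((fun a : 'rV[R]_n => a 0 i) @^-1` [set y | 0 <= y]))
      `&` ((fun a : 'rV[R]_n => \sum_i a 0 i) @^-1` [set y | y = 1])).
    apply: closedI.
      apply: closed_bigI => i _; apply: preimage_closed; last exact: closed_ge.
      by move=> a _; exact: coord_continuous.
    apply: preimage_closed; last exact: closed_eq.
    move=> a _; apply: continuous_big; first exact: add_continuous.
    by move=> i _; exact: coord_continuous.
  apply/seteqP; split=> a [a0 a1]; split=> // i; last exact: a0.
  by move=> _; exact: a0.
have mcont : continuous (fun a : 'rV[R]_n => max_market eps u x (a 0)).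
  pose c (a : 'rV[R]_n) v := vertex_payoff eps u x (a 0) v.
  have cc v : continuous (c ^~ v).
    apply: continuous_big; first exact: add_continuous.
    move=> k _ a; apply: cvgMr_tmp; first exact: nbhs_filter.
    exact: coord_continuous.
  have bigc r : continuous (fun a =>
      \big[Order.max/c a [ffun=> false]]_(v <- r) c a v).
    elim: r => [|v r IHr].
      by under eq_fun do rewrite big_nil; exact: cc.
    under eq_fun do rewrite big_cons.
    by apply: max_fun_continuous; [exact: cc|exact: IHr].
  rewrite (_ : (fun a => _) = fun a =>
    \big[Order.max/c a [ffun=> false]]_v c a v); first exact: bigc.
  by apply/funext => a; have [p _ []] := max_market_vertex eps u x (a 0).
have [a Da amin] := EVT_min_rV D0 Dcompact (continuous_subspaceT mcont).
move: Da; rewrite inE/= => Da.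
have rowE alpha : (\row_j alpha j) 0 = alpha :> ('I_n -> R).
  by apply/funext => j; rewrite mxE.
have am alpha : is_distribution alpha ->
    max_market eps u x (a 0) <= max_market eps u x alpha.
  move=> ald; have := amin (\row_j alpha j); rewrite rowE; apply.
  by rewrite inE /D/= rowE.
have ma : game_value eps u x = max_market eps u x (a 0).
  rewrite /game_value /set_min.
  case: xgetP => [m _ [[b bd <-] mlb]|/(_ (max_market eps u x (a 0)))].
    by apply/le_anti; rewrite am// andbT; apply: mlb; exists (a 0).
  by case; split; [exists (a 0)|move=> _ [b bd <-]; exact: am].
by split; [exists (a 0)|move=> al ald; rewrite ma; exact: am].
Qed.

End game.

(* Main.v *)
Require Import Defs.
From mathcomp Require Import all_boot all_order all_algebra.
From mathcomp Require Import all_classical all_reals all_analysis.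
From mathcomp Require Import measurable_realfun ring lra.

(* The equation is the fixed point equation u = T u of the map
   T u = eps^2 phi + (1 - eps^2) min max E[u (x + eps Dx)], which is monotone and
   satisfies T (u + c) = T u + (1 - eps^2) c.  These two properties give a
   comparison principle between sub- and supersolutions at bounded distance,
   hence uniqueness, and monotonicity and equivariance by comparing u with its
   translates.  If |T psi - psi| <= eps^2 K for psi the mollification of phi, then
   psi - K and psi + K are a sub- and a supersolution, whence existence
   (Knaster-Tarski) and the bound M = K.

   The value of the one-step game at psi is nonnegative, since the market may
   leave x fixed.  It is O(eps^2): as psi is monotone and equivariant, its
   increments along the staircase 0, e_0, e_0 + e_1, ... (scaled by eps) form
   eps times a probability vector, and against this strategy the payoff of any
   v in {0,1}^n is a sum of at most n mixed second differences of psi with steps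
   at most eps.  Such a difference is O(eps^2) because one of the two
   translations can be moved onto the Lipschitz mollifier, while monotonicity and
   equivariance make phi 1-Lipschitz for the sup norm. *)

Set Implicit Arguments.
Unset Strict Implicit.
Unset Printing Implicit Defensive.

Import Order.TTheory GRing.Theory Num.Theory.
Import numFieldNormedType.Exports.

Local Open Scope classical_set_scope.
Local Open Scope ring_scope.

(** * Monotone functions that commute with diagonal translations *)

Section monotone_equivariant.
Context (R : realType) (n : nat).
Implicit Types (x y : 'rV[R]_n) (f : 'rV[R]_n -> R).

(** The coordinates are raised one at a time: [z j] has the first [j] coordinates of [y] and the
    others of [x]. *)
Lemma nondecreasing_coord_le f x y : nondecreasing_coord f ->
  (forall i, x 0 i <= y 0 i) -> f x <= f y.
Proof.
move=> fnd xy.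
pose z (j : nat) : 'rV[R]_n := \row_i (if (i < j)%N then y 0 i else x 0 i).
have z0 : z 0%N = x by apply/rowP => i; rewrite mxE.
have zn : z n = y by apply/rowP => i; rewrite mxE ltn_ord.
have step j : (j <= n)%N -> f x <= f (z j).
  elim: j => [|j IHj] jn; first by rewrite z0.
  apply: (le_trans (IHj (ltnW jn))); apply: (fnd (Ordinal jn)) => [i ij|].
    rewrite !mxE ltnS [in RHS]leq_eqVlt.
    by rewrite -[X in X == _]/(nat_of_ord i) (_ : (_ == j)%N = false)//; exact/negbTE.
  by rewrite !mxE /= ltnn ltnSn.
by rewrite -zn; exact: step.
Qed.

(** Coordinatewise, [x] lies between the diagonal translates of [y] by [- d] and by [d]. *)
Lemma monotone_equivariant_dist f x y (d : R) :
  nondecreasing_coord f -> translation_equivariant f ->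
  (forall i, `|x 0 i - y 0 i| <= d) -> `|f x - f y| <= d.
Proof.
move=> fnd ftr xyd; rewrite ler_norml lerBlDl lerNl opprB lerBlDl -!ftr.
apply/andP; split; apply: nondecreasing_coord_le => // i; rewrite !mxE.
  by have := xyd i; rewrite ler_norml lerNl opprB lerBlDl => /andP[].
by have := xyd i; rewrite ler_norml lerBlDl => /andP[].
Qed.

End monotone_equivariant.

(** * The one-step game: monotonicity, translations and bounds on its value *)

Section game.
Context (R : realType) (n : nat).
Hypothesis n_ge1 : (1 <= n)%N.
Implicit Types (x y : 'rV[R]_n) (u w phi : 'rV[R]_n -> R) (eps : R).

(* [u x] plus the value of the one-step game, that is
   [min_player max_market E[u (x + eps Dx)]]. *)
Definition game_step eps u x : R := u x + game_value eps u x.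

Lemma expected_incrementD eps u x alpha p :
  is_distribution alpha -> is_distribution p ->
  u x + expected_increment eps u x alpha p =
  \sum_k alpha k * \sum_v p v * u (x + eps *: increment R k v).
Proof.
move=> [_ a1] [_ p1]; rewrite /expected_increment.
have uE : u x = \sum_k alpha k * u x by rewrite -mulr_suml a1 mul1r.
rewrite {1}uE -big_split/=; apply: eq_bigr => k _; rewrite -mulrDr; congr (_ * _).
under [in LHS]eq_bigr do rewrite mulrBr.
rewrite big_split/= sumrN -mulr_suml p1 mul1r.
by rewrite [LHS]addrC subrK.
Qed.

(** Let the player use a strategy optimal for [w] at [y], and the market its best reply to it for
    [u] at [x]; the two averages then compare term by term. Allowing two base points covers
    translates of a function as well. *)
Lemma game_step_le eps u w x y (B : R) :
  (forall k v, u (x + eps *: increment R k v) <=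
               w (y + eps *: increment R k v) + B) ->
  game_step eps u x <= game_step eps w y + B.
Proof.
move=> uwB; rewrite /game_step.
have [[a ad ->] _] := game_value_spec eps w y n_ge1.
have [_ /(_ _ ad) ule] := game_value_spec eps u x n_ge1.
apply: (@le_trans _ _ (u x + max_market eps u x a)); first by rewrite lerD2l.
have [[p pd ->] _] := max_market_spec eps u x a.
have [_ /(_ _ pd) wge] := max_market_spec eps w y a.
apply: (@le_trans _ _ (w y + expected_increment eps w y a p + B)); last first.
  by rewrite lerD2r lerD2l.
rewrite !expected_incrementD//.
have [a0 a1] := ad; have [p0 p1] := pd.
have -> : B = \sum_k a k * \sum_v p v * B.
  by rewrite -!mulr_suml a1 p1 !mul1r.
rewrite -big_split/=; apply: ler_sum => k _; rewrite -mulrDr ler_wpM2l//.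
rewrite -big_split/=; apply: ler_sum => v _; rewrite -mulrDr ler_wpM2l//.
Qed.

Lemma game_stepD eps u x (c : R) :
  game_step eps (fun y => u y + c) x = game_step eps u x + c.
Proof.
apply/le_anti/andP; split; first exact: game_step_le.
rewrite -lerBrDr; apply: game_step_le => k v.
by rewrite addrK.
Qed.

Lemma game_step_shift eps u x a :
  game_step eps (fun y => u (y + a)) x = game_step eps u (x + a).
Proof.
apply/le_anti/andP; split; rewrite -[leRHS]addr0; apply: game_step_le => k v.
  by rewrite addr0 addrAC.
by rewrite addr0 addrAC.
Qed.

Lemma increment0 (k : 'I_n) : increment R k [ffun=> false] = 0.
Proof. by apply/rowP => j; rewrite !mxE !ffunE subrr. Qed.

(** The market may put all its mass on [v = 0], for which every increment vanishes. *)
Lemma game_value_ge0 eps u x : 0 <= game_value eps u x.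
Proof.
have [[a ad ->] _] := game_value_spec eps u x n_ge1.
have [_ mge] := max_market_spec eps u x a.
pose p (v : {ffun 'I_n -> bool}) : R := (v == [ffun=> false])%:R.
have pd : is_distribution p.
  split=> [v|]; first by rewrite ler0n.
  by rewrite (bigD1 [ffun=> false])//= /p eqxx big1 ?addr0// => v /negbTE ->.
apply: le_trans (mge _ pd); rewrite /expected_increment big1// => k _.
rewrite big1 ?mulr0// => v _; rewrite /p.
by have [->|] := eqVneq; rewrite ?mul0r// increment0 scaler0 addr0 subrr mulr0.
Qed.

(** Against a fixed [alpha] the payoff is linear in [p], so it suffices to test deterministic moves
    [v] of the market. *)
Lemma game_value_le eps u x alpha (C : R) : is_distribution alpha ->
  (forall v, \sum_k alpha k * (u (x + eps *: increment R k v) - u x) <= C) ->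
  game_value eps u x <= C.
Proof.
move=> ad uC; have [_ /(_ _ ad) gle] := game_value_spec eps u x n_ge1.
apply: (le_trans gle).
have [[p [p0 p1] ->] _] := max_market_spec eps u x alpha.
rewrite /expected_increment; under eq_bigr do rewrite mulr_sumr.
rewrite exchange_big/= -[leRHS]mul1r -p1 mulr_suml; apply: ler_sum => v _.
under eq_bigr do rewrite mulrCA.
by rewrite -mulr_sumr ler_wpM2l.
Qed.

Definition solution_map phi eps u x : R :=
  eps ^+ 2 * phi x + (1 - eps ^+ 2) * game_step eps u x.

(** The defect in the fixed point equation is [eps ^+ 2] times the game operator. *)
Lemma game_operator_eq0 phi eps u x : 0 < eps ->
  game_operator phi eps u x = 0 <-> u x = solution_map phi eps u x.
Proof.
move=> e0; have e2 : eps ^+ 2 != 0 by rewrite expf_neq0// gt_eqF.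
rewrite /game_operator /solution_map /game_step.
set g := game_value _ _ _.
have E : u x - (eps ^+ 2 * phi x + (1 - eps ^+ 2) * (u x + g)) =
  eps ^+ 2 * (u x - phi x - (1 - eps ^+ 2) / eps ^+ 2 * g).
  by field; rewrite gt_eqF.
split=> h; first by apply/eqP; rewrite -subr_eq0 E h mulr0.
by apply: (mulfI e2); rewrite mulr0 -E -h subrr.
Qed.

(** * Comparison principle and existence between a sub- and a supersolution *)

Section solution_map.
Variables (phi : 'rV[R]_n -> R) (eps : R).
Hypothesis eps01 : 0 < eps < 1.

Let q_ge0 : 0 <= 1 - eps ^+ 2.
Proof. by case/andP: eps01 => *; nra. Qed.

Let q_lt1 : 1 - eps ^+ 2 < 1.
Proof. by case/andP: eps01 => *; nra. Qed.

Lemma solution_mapD u x (c : R) :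
  solution_map phi eps (fun y => u y + c) x =
  solution_map phi eps u x + (1 - eps ^+ 2) * c.
Proof. by rewrite /solution_map game_stepD mulrDr addrA. Qed.

Lemma solution_map_le u w x : (forall y, u y <= w y) ->
  solution_map phi eps u x <= solution_map phi eps w x.
Proof.
move=> uw; rewrite lerD2l ler_wpM2l// -[leRHS]addr0.
by apply: game_step_le => k v; rewrite addr0.
Qed.

(** With [S] the supremum of [u - w], finite thanks to [B], applying the map to [u <= w + S] gives
    [S <= (1 - eps ^+ 2) * S], hence [S <= 0]. *)
Lemma comparison u w (B : R) :
  (forall x, u x <= solution_map phi eps u x) ->
  (forall x, solution_map phi eps w x <= w x) ->
  (forall x, u x - w x <= B) -> forall x, u x <= w x.
Proof.
move=> usub wsup uwB.
pose S := range (fun x => u x - w x).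
have supS : has_sup S.
  by split; [exists (u 0 - w 0), 0|exists B => _ [x _ <-]].
have Sge x : u x - w x <= sup S by apply: ub_le_sup; [case: supS|exists x].
have Sle : sup S <= (1 - eps ^+ 2) * sup S.
  apply: ge_sup; first by case: supS.
  move=> _ [x _ <-]; rewrite lerBlDl.
  apply: (le_trans (usub x)).
  have /(solution_map_le x) : forall y, u y <= w y + sup S.
    by move=> y; rewrite -lerBlDl.
  rewrite solution_mapD => /le_trans; apply; by rewrite lerD2r.
have e2 : 0 < eps ^+ 2 by case/andP: eps01 => *; rewrite exprn_gt0.
have S0 : sup S <= 0 by rewrite -(pmulr_rle0 _ e2); lra.
by move=> x; rewrite -subr_le0; exact: le_trans S0.
Qed.

(* Knaster-Tarski: the supremum of all subsolutions below [w] is a solution. *)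
Lemma solution_between u w :
  (forall x, u x <= solution_map phi eps u x) ->
  (forall x, solution_map phi eps w x <= w x) ->
  (forall x, u x <= w x) ->
  exists s, [/\ forall x, s x = solution_map phi eps s x,
    forall x, u x <= s x & forall x, s x <= w x].
Proof.
move=> usub wsup uw.
pose F := [set z : 'rV[R]_n -> R |
  (forall x, z x <= solution_map phi eps z x) /\ (forall x, z x <= w x)].
have Fu : F u by [].
pose s x := sup [set z x | z in F].
have Fub x : ubound [set z x | z in F] (w x) by move=> _ [z [_ zw] <-].
have les z x : F z -> z x <= s x.
  by move=> Fz; apply: ub_le_sup; [exists (w x)|exists z].
have sle x (b : R) : (forall z, F z -> z x <= b) -> s x <= b.
  move=> zb; apply: ge_sup; first by exists (u x), u.
  by move=> _ [z Fz <-]; exact: zb.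
have sw x : s x <= w x by apply: sle => z [].
have ssub x : s x <= solution_map phi eps s x.
  apply: sle => z Fz; apply: (@le_trans _ _ (solution_map phi eps z x)).
    by case: Fz.
  by apply: solution_map_le => y; exact: les.
(* The image of [s] is again a subsolution below [w], hence at most [s]. *)
have FTs : F (solution_map phi eps s).
  split=> x; first exact: solution_map_le.
  apply: le_trans (wsup x); exact: solution_map_le.
exists s; split=> // x; last exact: les.
by apply/le_anti; rewrite ssub/= les.
Qed.

End solution_map.

(** * Well-posedness from an approximate solution [psi] *)

Section approximate_solution.
Variables (phi psi : 'rV[R]_n -> R) (K : R).
Hypotheses (phi_nd : nondecreasing_coord phi) (phi_tr : translation_equivariant phi).
Hypotheses (psi_nd : nondecreasing_coord psi) (psi_tr : translation_equivariant psi).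
Hypothesis psiK : forall eps x, 0 < eps < 1 ->
  `|solution_map phi eps psi x - psi x| <= eps ^+ 2 * K.

(** The map sends the constant [- K] to [- (1 - eps ^+ 2) * K]; the gain [eps ^+ 2 * K] absorbs the
    defect of [psi]. *)
Lemma subsolution eps x : 0 < eps < 1 ->
  psi x - K <= solution_map phi eps (fun y => psi y - K) x.
Proof.
move=> e01; rewrite solution_mapD.
by have := psiK x e01; rewrite ler_norml => /andP[]; lra.
Qed.

Lemma supersolution eps x : 0 < eps < 1 ->
  solution_map phi eps (fun y => psi y + K) x <= psi x + K.
Proof.
move=> e01; rewrite solution_mapD.
by have := psiK x e01; rewrite ler_norml => /andP[]; lra.
Qed.

Lemma error_bound_ge0 : 0 <= K.
Proof.
have h : 0 < (2^-1 : R) < 1 by lra.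
by have := le_trans (normr_ge0 _) (psiK 0 h); rewrite pmulr_rge0//; lra.
Qed.

(** Comparison with the barriers [psi - K] and [psi + K]. The a priori bound [B] only makes
    comparison applicable and does not enter the result. *)
Lemma solution_bound eps u : 0 < eps < 1 -> bounded_difference u psi ->
  (forall x, u x = solution_map phi eps u x) ->
  forall x, `|u x - psi x| <= K.
Proof.
move=> e01 [B uB] uT x.
have K0 := error_bound_ge0.
rewrite ler_norml lerBlDl; apply/andP; split; last first.
  apply: (@comparison phi eps e01 u (fun y => psi y + K) B) => [y|y|y].
  - by rewrite {1}uT.
  - exact: supersolution.
  - by have := uB y; rewrite ler_norml => /andP[]; lra.
rewrite lerBrDl.
apply: (@comparison phi eps e01 (fun y => psi y - K) u B) => [y|y|y].
- exact: subsolution.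
- by rewrite {1}uT.
- by have := uB y; rewrite ler_norml => /andP[]; lra.
Qed.

Lemma solution_exists eps : 0 < eps < 1 -> exists2 u,
  bounded_difference u psi & forall x, u x = solution_map phi eps u x.
Proof.
move=> e01; have K0 := error_bound_ge0.
have [|||s [sT us sw]] := @solution_between phi eps e01
    (fun y => psi y - K) (fun y => psi y + K).
- by move=> x; exact: subsolution.
- by move=> x; exact: supersolution.
- by move=> x; lra.
by exists s => //; exists K => x; rewrite ler_norml; have := us x; have := sw x; lra.
Qed.

Lemma solution_unique eps u w : 0 < eps < 1 ->
  bounded_difference u psi -> bounded_difference w psi ->
  (forall x, u x = solution_map phi eps u x) ->
  (forall x, w x = solution_map phi eps w x) -> u = w.
Proof.
move=> e01 ub wb uT wT.
have le12 z z' : bounded_difference z psi -> bounded_difference z' psi ->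
  (forall x, z x = solution_map phi eps z x) ->
  (forall x, z' x = solution_map phi eps z' x) -> forall x, z x <= z' x.
  move=> [B zB] [B' zB'] zT z'T.
  apply: (comparison e01 (B := B + B')) => [y|y|y].
  - by rewrite {1}zT.
  - by rewrite {1}z'T.
  - by have := zB y; have := zB' y; rewrite !ler_norml => /andP[? ?] /andP[]; lra.
by apply/funext => x; apply/le_anti; rewrite !le12.
Qed.

Lemma solution_nondecreasing eps u : 0 < eps < 1 -> bounded_difference u psi ->
  (forall x, u x = solution_map phi eps u x) -> nondecreasing_coord u.
Proof.
move=> e01 [B uB] uT j x y xyi xyj.
pose a := y - x.
have a0 i : 0 <= a 0 i.
  by rewrite !mxE subr_ge0; have [->//|/xyi ->] := eqVneq i j.
have aE (z : 'rV[R]_n) i : z 0 i <= (z + a) 0 i.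
  by have := a0 i; rewrite !mxE lerDl.
suff /(_ x) : forall z, u z <= u (z + a) by rewrite addrC subrK.
(* As [phi] is monotone, the translate of [u] by [a] is a supersolution. Since
   [psi z <= psi (z + a)], passing from [u] to [psi] at both points costs [B] twice. *)
apply: (comparison e01 (B := B + B) (w := fun z => u (z + a))) => [z|z|z].
- by rewrite {1}uT.
- rewrite uT /solution_map game_step_shift lerD2r.
  rewrite ler_wpM2l ?exprn_ge0//; first by case/andP: e01 => /ltW.
  exact: nondecreasing_coord_le.
- have := nondecreasing_coord_le psi_nd (aE z).
  by have := uB z; have := uB (z + a); rewrite !ler_norml => /andP[? ?] /andP[]; lra.
Qed.

(** The function [u (y + c) - c] solves the same equation and stays at bounded distance from [psi],
    so uniqueness applies. *)
Lemma solution_equivariant eps u : 0 < eps < 1 -> bounded_difference u psi ->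
  (forall x, u x = solution_map phi eps u x) -> translation_equivariant u.
Proof.
move=> e01 ub uT x c.
suff /(congr1 (fun f => f x)) -> : u = (fun y => u (y + const_mx c) - c).
  by rewrite subrK.
apply: (solution_unique e01) => // [|y].
- have [B uB] := ub; exists B => y.
  by rewrite addrAC -addrA -opprD -psi_tr.
- rewrite uT solution_mapD /solution_map game_step_shift phi_tr; ring.
Qed.

Lemma approximate_solution_wellposed :
  (forall eps, 0 < eps < 1 -> exists! u, bounded_difference u psi /\
    forall x, game_operator phi eps u x = 0) /\
  exists M : R, forall eps u, 0 < eps < 1 ->
    bounded_difference u psi /\ (forall x, game_operator phi eps u x = 0) ->
    [/\ forall x, `|u x - psi x| <= M, nondecreasing_coord u &
        translation_equivariant u].
Proof.
have opE eps u : 0 < eps < 1 -> (forall x, game_operator phi eps u x = 0) <->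
    (forall x, u x = solution_map phi eps u x).
  by case/andP=> e0 _; split=> h x; apply/game_operator_eq0.
split=> [eps e01|].
  have [u ub uT] := solution_exists e01.
  exists u; split=> [|w [wb /opE wT]]; first by split=> //; apply/opE.
  exact: (solution_unique e01) (wT e01).
exists K => eps u e01 [ub /(opE _ _ e01) uT]; split.
- exact: solution_bound uT.
- exact: solution_nondecreasing uT.
- exact: solution_equivariant uT.
Qed.

End approximate_solution.

(** Here [s j v] keeps the first [j] entries of [v], and [D k v] is the [k]-th increment of [psi]
    along this staircase. Against [alpha], the move [v] pays the sum over [k] of
    [D k v - D k one * v k]: the term is zero if [v k] is false, and a second difference
    otherwise. *)
Lemma game_value_second_difference psi eps x (C : R) : 0 < eps ->
  nondecreasing_coord psi -> translation_equivariant psi ->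
  (forall (k : 'I_n) (y z : 'rV[R]_n), (forall i, `|y 0 i - z 0 i| <= eps) ->
    `|psi (y + eps *: delta_mx 0 k) - psi y -
      (psi (z + eps *: delta_mx 0 k) - psi z)| <= C) ->
  game_value eps psi x <= n%:R * C.
Proof.
move=> e0 psi_nd psi_tr psiC.
pose s (j : nat) (v : {ffun 'I_n -> bool}) : 'rV[R]_n :=
  \row_i ((i < j)%N && v i)%:R.
pose one : {ffun 'I_n -> bool} := [ffun=> true].
pose D (k : nat) v := psi (x + eps *: s k.+1 v) - psi (x + eps *: s k v).
have s0 v : s 0%N v = 0 by apply/rowP => i; rewrite !mxE.
have sn v : s n v = \row_i (v i)%:R by apply/rowP => i; rewrite !mxE ltn_ord.
have sumD v : \sum_(k < n) D k v = psi (x + eps *: s n v) - psi x.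
  rewrite -(big_mkord xpredT (fun k => D k v)) telescope_sumr// s0.
  by rewrite scaler0 addr0.
have snone : x + eps *: s n one = x + const_mx eps.
  by rewrite sn; congr (_ + _); apply/rowP => i; rewrite !mxE ffunE mulr1.
have sS (k : 'I_n) v : s k.+1 v = s k v + (v k)%:R *: delta_mx 0 k.
  apply/rowP => i; rewrite !mxE eqxx/= ltnS leq_eqVlt -[(i == k :> nat)]/(i == k).
  have [->|_] := eqVneq i k; first by rewrite ltnn/= add0r mulr1.
  by rewrite mulr0 addr0.
pose alpha (k : 'I_n) := D k one / eps.
(* The weights are nonnegative by monotonicity; they sum to one because the full staircase is the
   diagonal step [eps], which raises [psi] by exactly [eps]. *)
have ad : is_distribution alpha.
  split=> [k|].
    rewrite divr_ge0 ?(ltW e0)// subr_ge0; apply: nondecreasing_coord_le => // i.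
    rewrite !mxE lerD2l ler_pM2l// ler_nat !ffunE !andbT.
    by rewrite ltnS; case: (ltnP i k) => [/ltnW ->|].
  by rewrite -mulr_suml sumD snone psi_tr addrAC subrr add0r divff// gt_eqF.
apply: (game_value_le ad) => v.
(* Equivariance splits off the diagonal part [- v k] of the increment. *)
have incE k : psi (x + eps *: increment R k v) - psi x =
    psi (x + eps *: s n v) - psi x - eps * (v k)%:R.
  rewrite [RHS]addrAC -(psi_tr _ (- (eps * (v k)%:R))); congr (psi _ - _).
  by rewrite sn -addrA; congr (_ + _); apply/rowP => i; rewrite !mxE mulrBr.
under eq_bigr do rewrite incE mulrBr.
rewrite big_split/= -mulr_suml; case: (ad) => _ ->; rewrite mul1r -sumD.
rewrite -big_split/=.
have -> : n%:R * C = \sum_(k < n) C by rewrite sumr_const card_ord mulr_natl.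
apply: ler_sum => k _.
have -> : alpha k * (eps * (v k)%:R) = D k one * (v k)%:R.
  by rewrite /alpha mulrA divfK// gt_eqF.
have C0 : 0 <= C.
  by apply: le_trans (psiC k 0 0 _) => // i; rewrite subrr normr0 ltW.
rewrite /D !sS ffunE scale1r !scalerDr; have [vk|vk] := boolP (v k); last first.
  by rewrite scale0r scaler0 addr0 subrr mulr0 subrr.
rewrite mulr1 scale1r !addrA; apply: (le_trans (ler_norm _)).
apply: psiC => i; rewrite !mxE !ffunE andbT opprD addrACA subrr add0r -mulrBr.
rewrite normrM gtr0_norm// ler_piMr// ?(ltW e0)//.
by case: (_ < _)%N; case: (v i); rewrite /= ?subr0 ?sub0r ?subrr ?normrN ?normr0 ?normr1.
Qed.

End game.

(** * Translation invariance of Lebesgue measure on the line *)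

Section lebesgue_translation.
Context (R : realType).
Local Notation mu := (@lebesgue_measure R).

Lemma measurable_translation (a : R) :
  measurable_fun setT (fun x : measurableTypeR R => x + a : measurableTypeR R).
Proof. exact: measurable_funD. Qed.

(** By uniqueness of Lebesgue measure, checking half-open intervals is enough. *)
Lemma lebesgue_measure_translation (a : R) (A : set (measurableTypeR R)) :
  measurable A -> mu ((fun x => x + a) @^-1` A) = mu A.
Proof.
move=> mA.
rewrite -[LHS]/(pushforward mu
  (fun x : measurableTypeR R => x + a : measurableTypeR R) A).
apply/esym/lebesgue_measure_unique => //=; first exact: measurable_translation.
move=> mf _ [[c d]] _ <-.
rewrite /pushforward/=.
rewrite (_ : _ @^-1` _ = `]c - a, d - a]%classic); last first.
  by apply/seteqP; split => x /=; rewrite !in_itv/= ltrBlDr lerBrDr.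
rewrite !lebesgue_measure_itv/= !lte_fin ltrD2r.
rewrite EFinN; case: ifP => // _; congr EFin; ring.
Qed.

Lemma ge0_integral_translation (a : R) (f : R -> \bar R) :
  measurable_fun setT f -> (forall x, (0 <= f x)%E) ->
  (\int[mu]_x f (x + a)%R = \int[mu]_x f x)%E.
Proof.
move=> mf f0.
pose g := (fun x : measurableTypeR R => x + a : measurableTypeR R).
transitivity (\int[pushforward mu g]_x f x)%E.
  rewrite ge0_integral_pushforward//.
  exact: measurable_translation.
apply: eq_measure_integral => [|mg A mA _]; first exact: measurable_translation.
exact: lebesgue_measure_translation.
Qed.

End lebesgue_translation.

(** * Translation invariance, integrability and measurability on tuples *)

Section lebesgue_tuple.
Context (R : realType).
Local Notation RM := (measurableTypeR R).

Definition shift_tuple n (a : 'I_n -> R) (t : n.-tuple RM) : n.-tuple RM :=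
  [tuple (tnth t i + a i : RM) | i < n].

Lemma measurable_shift_tuple n (a : 'I_n -> R) :
  measurable_fun setT (shift_tuple a).
Proof.
apply/measurable_fun_tnthP => i.
rewrite (_ : _ \o _ = fun t => tnth t i + a i); last first.
  by apply/funext => t /=; rewrite tnth_mktuple.
by apply: measurable_funD => //; exact: measurable_tnth.
Qed.

Lemma shift_tuple_cons n (a : 'I_n.+1 -> R) (x : RM) (t : n.-tuple RM) :
  shift_tuple a (cons_pair (x, t)) =
  cons_pair ((x + a ord0 : RM), shift_tuple (fun i => a (lift ord0 i)) t).
Proof.
apply: eq_from_tnth => i; rewrite tnth_mktuple.
case: (unliftP ord0 i) => [j ->|->]; last by rewrite !tnth0.
by rewrite !tnthS tnth_mktuple.
Qed.

(** Induction through the product measure: the hypothesis shifts the sections, and the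
    one-dimensional invariance shifts the first coordinate. *)
Lemma lebesgue_tuple_shift n (a : 'I_n -> R) (A : set (n.-tuple RM)) :
  measurable A -> lebesgue_tuple R n (shift_tuple a @^-1` A) = lebesgue_tuple R n A.
Proof.
elim: n => [|n IHn] in a A *.
  move=> _; congr (lebesgue_tuple _ _ _); apply/seteqP.
  by split=> t /=; rewrite (tuple0 (shift_tuple a t)) (tuple0 t).
move=> mA.
have mB : measurable (@cons_pair RM n @^-1` A).
  by rewrite -[X in measurable X]setTI; exact: measurable_cons_pair.
pose g x := lebesgue_tuple R n (xsection (@cons_pair RM n @^-1` A) x).
transitivity (\int[lebesgue_measure]_x g (x + a ord0)%R)%E.
  apply: eq_integral => x _ /=.
  rewrite -/(lebesgue_tuple R n).
  rewrite /g -(IHn (fun i => a (lift ord0 i))); last exact: measurable_xsection.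
  congr (lebesgue_tuple R n _); apply/seteqP.
  by split=> t /=; rewrite /xsection/= !inE/= !shift_tuple_cons.
rewrite ge0_integral_translation//.
exact: measurable_fun_xsection.
Qed.

(** A cube is a product of intervals, so its measure follows by induction; multiples of its
    indicator serve as dominating functions. *)
Definition box n (r : R) : set (n.-tuple RM) :=
  [set t | forall i, `|tnth t i| <= r].

Lemma measurable_box n r : measurable (@box n r).
Proof.
rewrite (_ : box r = \bigcap_(i in [set: 'I_n]) ((@tnth _ RM)^~ i @^-1` `[-r, r]%classic)).
  apply: fin_bigcap_measurable => [|i _]; first exact: finite_finset.
  by rewrite -[X in measurable X]setTI; apply: measurable_tnth.
by apply/seteqP; split=> t /= h i; have := h i; rewrite /= in_itv/= -ler_norml; auto.
Qed.

Lemma lebesgue_tuple_box n r : 0 <= r ->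
  lebesgue_tuple R n (box r) = ((r *+ 2) ^+ n)%:E.
Proof.
move=> r0; elim: n => [|n IHn].
  by rewrite expr0 /= diracE mem_set// => -[].
have E : @cons_pair RM n @^-1` (box r) = `[-r, r]%classic `*` (box r).
  apply/seteqP; split=> [[x t] h|[x t] /= [h1 h2] i].
    split=> /=; first by have := h ord0; rewrite tnth0 in_itv/= -ler_norml.
    by move=> i; have := h (lift ord0 i); rewrite tnthS.
  case: (unliftP ord0 i) => [j ->|->]; rewrite ?tnthS//.
  by rewrite tnth0 ler_norml; move: h1; rewrite in_itv.
rewrite -[LHS]/((lebesgue_measure \x lebesgue_tuple R n)%E
  (@cons_pair RM n @^-1` (box r))) E.
transitivity (lebesgue_measure `[(- r)%R, r]%classic * lebesgue_tuple R n (@box n r))%E.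
  by apply: product_measure1E => //; exact: measurable_box.
rewrite lebesgue_measure_itv/= IHn exprS EFinM; congr (_ * _)%E.
rewrite lte_fin opprK -mulr2n; case: ltP => // rr.
by rewrite (_ : r = 0) ?mul0rn//; lra.
Qed.

Lemma integrable_shift n (a : 'I_n -> R) (f : n.-tuple RM -> R) :
  (lebesgue_tuple R n).-integrable setT (EFin \o f) ->
  (lebesgue_tuple R n).-integrable setT (EFin \o (f \o shift_tuple a)).
Proof.
move=> /integrableP[mf foo]; apply/integrableP; split.
  exact: (measurableT_comp mf (measurable_shift_tuple a)).
apply: le_lt_trans foo; rewrite le_eqVlt; apply/orP; left; apply/eqP.
transitivity (\int[pushforward (lebesgue_tuple R n) (shift_tuple a)]_t
    `|(EFin \o f) t|)%E.
  rewrite ge0_integral_pushforward//; first exact: measurable_shift_tuple.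
  exact: measurableT_comp.
apply: eq_measure_integral => [|mg A mA _]; first exact: measurable_shift_tuple.
exact: lebesgue_tuple_shift.
Qed.

Lemma RintegralT_shift n (a : 'I_n -> R) (f : n.-tuple RM -> R) :
  (lebesgue_tuple R n).-integrable setT (EFin \o f) ->
  \int[lebesgue_tuple R n]_t f (shift_tuple a t) = \int[lebesgue_tuple R n]_t f t.
Proof.
move=> intf; congr fine.
transitivity (\int[pushforward (lebesgue_tuple R n) (shift_tuple a)]_t
    (EFin \o f) t)%E.
  rewrite integral_pushforward//; first exact: measurable_shift_tuple.
    by case/integrableP: intf.
  by rewrite preimage_setT; exact: integrable_shift.
apply: eq_measure_integral => [|mg A mA _]; first exact: measurable_shift_tuple.
exact: lebesgue_tuple_shift.
Qed.

Lemma integrable_indic_box n r : 0 <= r ->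
  (lebesgue_tuple R n).-integrable setT
    (EFin \o (\1_(@box n r) : n.-tuple RM -> R)).
Proof.
move=> r0; apply/integrableP; split.
  by apply/measurable_EFinP; apply: measurable_indic; exact: measurable_box.
under eq_integral do rewrite /= ger0_norm//.
rewrite integral_indic//; last exact: measurable_box.
by rewrite setIT [X in (X < _)%E](lebesgue_tuple_box n r0) ltry.
Qed.

Lemma integrable_box n r (C : R) (f : n.-tuple RM -> R) : 0 <= r ->
  measurable_fun setT f ->
  (forall t, `|f t| <= C * \1_(@box n r) t) ->
  (lebesgue_tuple R n).-integrable setT (EFin \o f).
Proof.
move=> r0 mf fC.
have := integrableZl measurableT C (integrable_indic_box n r0).
apply: le_integrable => //; first exact/measurable_EFinP.
by move=> t _; rewrite -EFinM !abse_EFin lee_fin (le_trans (fC t))// ler_norm.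
Qed.

Lemma RintegralT_box n r : 0 <= r ->
  \int[lebesgue_tuple R n]_t (\1_(@box n r) t : R) = (r *+ 2) ^+ n.
Proof.
move=> r0; rewrite /Rintegral integral_indic//; last exact: measurable_box.
by rewrite setIT [X in fine X](lebesgue_tuple_box n r0).
Qed.

(* [{f < c}] is the union of the orthants [{x | x <= q}] over the rational
   points [q] with [f q < c]. *)
Lemma measurable_monotone_equivariant n (f : 'rV[R]_n -> R) :
  nondecreasing_coord f -> translation_equivariant f ->
  measurable_fun setT (f \o @row_of_tuple R n).
Proof.
move=> fnd ftr.
pose rowq (q : 'rV[rat]_n) : 'rV[R]_n := \row_i ratr (q 0 i).
apply: (measurability _ (RGenInftyO.measurableE R)).
move=> _ [_ [c ->] <-]; rewrite setTI.
pose F q := [set t : n.-tuple RM |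
  (forall i, tnth t i <= rowq q 0 i) /\ f (rowq q) < c].
rewrite (_ : _ @^-1` _ = \bigcup_q F q); last first.
  apply/seteqP; split=> [t /=|t [q _ [tq qc]]]; rewrite /= in_itv/=; last first.
    by apply: le_lt_trans qc; apply: nondecreasing_coord_le => // i; rewrite mxE.
  (* Raising each coordinate to a rational less than [d] away raises [f] by at most [d], half of the
     gap to [c]. *)
  move=> tc; pose d := (c - f (row_of_tuple t)) / 2.
  have d0 : 0 < d by rewrite divr_gt0// subr_gt0.
  have /(_ _)/cid-/all_sig [q qP] : forall i : 'I_n, exists q : rat,
      ratr q \in `](tnth t i : R), (tnth t i : R) + d[.
    by move=> i; apply: rat_in_itvoo; rewrite ltrDl.
  exists (\row_i q i) => //; split.
    by move=> i; rewrite !mxE; have := qP i; rewrite in_itv/= => /andP[/ltW].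
  apply: (@le_lt_trans _ _ (f (row_of_tuple t) + d)); last by rewrite /d; lra.
  rewrite -lerBlDl; apply: le_trans (ler_norm _) _.
  apply: monotone_equivariant_dist => // i; rewrite !mxE.
  by have := qP i; rewrite in_itv/= => /andP[? ?]; rewrite ler_norml; lra.
apply: countable_bigcupT_measurable => // q.
have [qc|qc] := boolP (f (rowq q) < c); last first.
  by rewrite (_ : F q = set0)//; apply/seteqP; split=> // t [_]; rewrite (negbTE qc).
rewrite (_ : F q = \bigcap_(i in [set: 'I_n])
    ((@tnth _ RM)^~ i @^-1` `]-oo, rowq q 0 i]%classic)).
  apply: fin_bigcap_measurable => [|i _]; first exact: finite_finset.
  by rewrite -[X in measurable X]setTI; apply: measurable_tnth.
apply/seteqP; split=> [t [tq _] i _|t tq]; first by rewrite /= in_itv/=; exact: tq.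
by split=> // i; have := tq i I; rewrite /= in_itv.
Qed.

End lebesgue_tuple.

(** * Lipschitz estimates and positivity for the bump function *)

Section bump.
Context (R : realType).

Definition expinv (r : R) : R := if 0 < r then expR (- r^-1) else 0.

Lemma expinv_ge0 r : 0 <= expinv r.
Proof. by rewrite /expinv; case: ifP => // _; exact: expR_ge0. Qed.

Lemma expinv_gt0 r : 0 < r -> 0 < expinv r.
Proof. by rewrite /expinv => ->; exact: expR_gt0. Qed.

Lemma expinv_le1 r : expinv r <= 1.
Proof.
by rewrite /expinv; case: ifP => // r0; rewrite -expR0 ler_expR oppr_le0 invr_ge0 ltW.
Qed.

Lemma expinv_le_id r : 0 <= r -> expinv r <= r.
Proof.
rewrite /expinv; case: ifP => // r0 _; rewrite expRN -[leRHS]invrK lef_pV2 ?posrE ?expR_gt0 ?invr_gt0//.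
by apply: le_trans (expR_ge1Dx _); rewrite lerDr.
Qed.

Lemma measurable_expinv : measurable_fun setT expinv.
Proof.
(* For positive [r] the inverse is written [expR (- ln r)], which leaves a composition of measurable
   functions. *)
rewrite (_ : expinv = fun r : R => if 0 < r then expR (- expR (- ln r)) else 0).
  apply: measurable_fun_ifT => //; first exact: measurable_fun_ltr.
  do 2 (apply: measurableT_comp => //; apply: measurableT_comp => //).
apply/funext => r; rewrite /expinv; case: ifP => // r0.
by rewrite (expRN (ln r)) lnK ?posrE.
Qed.

(** If [r <= 0] or [s > 2 * r], [expinv s <= s] suffices. Otherwise, with [w] and [v] the inverses
    of [r] and [s], the increment is at most [expR (- v) * w * v * (s - r)], where [w <= 2 * v] and
    [v ^+ 2 * expR (- v) <= 4]; hence the constant 8. *)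
Lemma expinv_lipschitz r s : r <= s ->
  0 <= expinv s - expinv r <= 8 * (s - r).
Proof.
move=> rs; have [r0|r0] := ltP 0 r; last first.
  rewrite {2 4}/expinv ltNge r0/= subr0 expinv_ge0/=.
  have [s0|s0] := ltP 0 s; last by rewrite /expinv ltNge s0/=; lra.
  by apply: (le_trans (expinv_le_id (ltW s0))); lra.
have s0 : 0 < s by exact: lt_le_trans rs.
rewrite /expinv r0 s0; apply/andP; split.
  by rewrite subr_ge0 ler_expR lerN2 lef_pV2.
have [sr|sr] := leP s (2 * r); last first.
  have /expinv_le_id := ltW s0; rewrite /expinv s0 => h.
  by have := expR_ge0 (- r^-1); lra.
set w := r^-1; set v := s^-1.
have v0 : 0 < v by rewrite invr_gt0.
have wv : w - v = (s - r) * (w * v) by rewrite /w /v; field; rewrite !gt_eqF.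
have w2v : w <= 2 * v.
  by rewrite /w /v ler_pdivlMr// mulrC ler_pdivrMr.
have E : expR (- v) - expR (- w) <= expR (- v) * (w - v).
  rewrite (_ : - w = - v + - (w - v)); last by ring.
  rewrite expRD -[X in X - _]mulr1 -mulrBr ler_wpM2l ?expR_ge0//.
  by have := expR_ge1Dx (- (w - v)); lra.
apply: (le_trans E); rewrite wv mulrCA mulrC ler_wpM2r ?subr_ge0//.
have -> : expR (- v) = expR (- (v / 2)) ^+ 2 by rewrite expr2 -expRD; congr expR; lra.
set b := expR _; have b0 : 0 < b by exact: expR_gt0.
have bv : b * v <= 2.
  rewrite /b expRN ler_pdivrMl ?expR_gt0//.
  by have := expR_ge1Dx (v / 2); lra.
have bv0 : 0 <= b * v by rewrite mulr_ge0// ltW.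
apply: (@le_trans _ _ (2 * (b * v) ^+ 2)); last by nra.
rewrite exprMn; have := expr2 v; nra.
Qed.

Context (n : nat).
Local Notation RM := (measurableTypeR R).
Implicit Types t : n.-tuple RM.

Lemma bumpE t :
  Defs.bump (row_of_tuple t) = expinv (1 - \sum_i (tnth t i : R) ^+ 2).
Proof.
rewrite /Defs.bump /enorm; under eq_bigr do rewrite mxE.
set S := \sum_i _; have S0 : 0 <= S by apply: sumr_ge0 => i _; exact: sqr_ge0.
by rewrite sqr_sqrtr// /expinv subr_gt0 -{1}sqrtr1 ltr_sqrt// ltr01.
Qed.

Lemma measurable_bump :
  measurable_fun setT (@Defs.bump R n \o @row_of_tuple R n).
Proof.
rewrite (_ : _ \o _ = expinv \o (fun t => 1 - \sum_i (tnth t i : R) ^+ 2)); last first.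
  by apply/funext => t /=; rewrite bumpE.
apply: measurableT_comp; first exact: measurable_expinv.
apply: measurable_funB => //; apply: measurable_sum => i.
by apply: measurable_funX; exact: measurable_tnth.
Qed.

Lemma bump_outside t : ~ box 1 t -> Defs.bump (row_of_tuple t) = 0.
Proof.
move=> /existsNP[i /negP]; rewrite -ltNge => ti.
rewrite bumpE /expinv ifF//; apply/negbTE; rewrite -leNgt subr_le0.
rewrite (bigD1 i)//= -[leLHS]addr0 lerD//; last first.
  by apply: sumr_ge0 => j _; exact: sqr_ge0.
by rewrite -real_normK ?num_real// expr_ge1// ltW.
Qed.

Lemma bump_ge0 t : 0 <= Defs.bump (row_of_tuple t).
Proof. by rewrite bumpE expinv_ge0. Qed.

Lemma bump_le_indic t : `|Defs.bump (row_of_tuple t)| <= 1 * \1_(@box R n 1) t.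
Proof.
rewrite ger0_norm ?bump_ge0// mul1r indicE; have [_|] := boolP (t \in _).
  by rewrite bumpE expinv_le1.
by move/negP; rewrite inE => /bump_outside ->.
Qed.

Lemma integral_bump_gt0 : 0 < integral_rV (@Defs.bump R n).
Proof.
(* This half side satisfies [n * r ^+ 2 < 1], so the cube lies inside the unit ball and the bump is
   at least [e] on it. *)
pose r : R := (2 * n.+1%:R)^-1.
have r0 : 0 < r by rewrite invr_gt0 mulr_gt0.
pose e := expinv (1 - n%:R * r ^+ 2).
have nr : n%:R * r ^+ 2 < 1.
  have r1 : r * (2 * n.+1%:R) = 1 by rewrite mulVf// gt_eqF// mulr_gt0.
  have n0 : 0 <= (n%:R : R) by [].
  by move: r1; rewrite -natr1; nra.
have e0 : 0 < e by apply: expinv_gt0; lra.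
apply: (@lt_le_trans _ _ (e * (r *+ 2) ^+ n)).
  by rewrite mulr_gt0// exprn_gt0// mulrn_wgt0.
rewrite -RintegralT_box ?(ltW r0)// -RintegralZl//; last first.
  by apply: integrable_indic_box; exact: ltW.
apply: le_Rintegral => //.
- exact/(integrableZl _ _ (integrable_indic_box n (ltW r0))).
- apply: (@integrable_box _ _ 1 1) => //; first exact: measurable_bump.
  exact: bump_le_indic.
- move=> t _; rewrite indicE; have [|_] := boolP (t \in _); last first.
    by rewrite mulr0 bump_ge0.
  rewrite inE mulr1 bumpE /e => tr.
  set S := \sum_i _; have Sr : S <= n%:R * r ^+ 2.
    rewrite -[X in X%:R](card_ord n) mulr_natl -sumr_const ler_sum// => i _.
    by rewrite -real_normK ?num_real// ler_pXn2r ?nnegrE// ltW.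
  rewrite -subr_ge0.
  have /expinv_lipschitz/andP[//] : 1 - n%:R * r ^+ 2 <= 1 - S by lra.
Qed.

(** Since [a <= 1], both terms vanish off the cube of half side 2. On it the squared norm changes by
    [a * (2 * tnth t k + a)], at most [5 * a] in absolute value, and [expinv] has Lipschitz constant
    8. *)
Lemma bump_shift (k : 'I_n) (a : R) t : 0 <= a <= 1 ->
  `|Defs.bump (row_of_tuple (shift_tuple (fun i => a *+ (i == k)) t)) -
    Defs.bump (row_of_tuple t)| <= 40 * a * \1_(@box R n 2) t.
Proof.
move=> /andP[a0 a1]; set t' := shift_tuple _ t.
have t'E i : tnth t' i = (tnth t i : R) + a *+ (i == k) by rewrite tnth_mktuple.
rewrite indicE; have [|/negP] := boolP (t \in _); rewrite inE => tb; last first.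
  rewrite !bump_outside ?subrr ?normr0 ?mulr0//.
    move=> t1; apply: tb => i; apply: (le_trans (t1 i)); lra.
  move=> t1; apply: tb => i; have := t1 i; rewrite t'E.
  by case: (i == k); rewrite ?mulr1n ?mulr0n !ler_norml; lra.
rewrite mulr1 !bumpE.
have -> : \sum_i (tnth t' i : R) ^+ 2 = \sum_i (tnth t i : R) ^+ 2 +
    a * (2 * tnth t k + a).
  rewrite (bigD1 k)//= [in RHS](bigD1 k)//= t'E eqxx mulr1n.
  under eq_bigr => i /negbTE ik do rewrite t'E ik mulr0n addr0.
  ring.
set S := \sum_i _; set d := a * _.
have dle : `|d| <= 5 * a.
  by rewrite /d normrM ger0_norm// mulrC ler_wpM2r//; have := tb k; rewrite !ler_norml; lra.
have [d0|d0] := leP 0 d.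
  have /expinv_lipschitz : 1 - (S + d) <= 1 - S by lra.
  rewrite distrC => /andP[h1 h2]; rewrite ger0_norm//.
  by apply: (le_trans h2); move: dle; rewrite ler_norml; lra.
have /expinv_lipschitz : 1 - S <= 1 - (S + d) by lra.
move=> /andP[h1 h2]; rewrite ger0_norm//.
by apply: (le_trans h2); move: dle; rewrite ler_norml; lra.
Qed.

End bump.

(** * The mollified payoff as an approximate solution *)

Section mollification.
Context (R : realType) (n : nat).
Local Notation RM := (measurableTypeR R).
Local Notation mu := (lebesgue_tuple R n).
Implicit Types (t : n.-tuple RM) (x y : 'rV[R]_n).

Let c : R := (integral_rV (@Defs.bump R n))^-1.
Let eta t : R := mollifier (row_of_tuple t).

Let c_gt0 : 0 < c.
Proof. by rewrite invr_gt0 integral_bump_gt0. Qed.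

Let eta_ge0 t : 0 <= eta t.
Proof. by rewrite mulr_ge0 ?bump_ge0// ltW. Qed.

Let measurable_eta : measurable_fun setT eta.
Proof. by apply: measurable_funM => //; exact: measurable_bump. Qed.

Let eta_box t : `|eta t| <= c * \1_(@box R n 2) t.
Proof.
rewrite /eta /mollifier normrM (gtr0_norm c_gt0) ler_wpM2l ?(ltW c_gt0)//.
apply: (le_trans (bump_le_indic t)); rewrite mul1r !indicE ler_nat.
case: (boolP (t \in box 1)) => //; rewrite inE => t1.
by rewrite mem_set// => i; apply: (le_trans (t1 i)); lra.
Qed.

Let integrable_eta : mu.-integrable setT (EFin \o eta).
Proof. exact: integrable_box eta_box. Qed.

Let integral_eta : \int[mu]_t eta t = 1.
Proof.
rewrite /eta /mollifier RintegralZl ?mulVf ?gt_eqF ?integral_bump_gt0//.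
apply: (@integrable_box _ _ 1 1) => //; first exact: measurable_bump.
exact: bump_le_indic.
Qed.

Section payoff.
Variable phi : 'rV[R]_n -> R.
Hypotheses (phi_nd : nondecreasing_coord phi) (phi_tr : translation_equivariant phi).

(** The two sign changes in [- phi (x - y)] make it monotone and equivariant in [y]. *)
Let measurable_phi x : measurable_fun setT (fun t => phi (x - row_of_tuple t)).
Proof.
have nd : nondecreasing_coord (fun y => - phi (x - y)).
  move=> j y z yz yzj; rewrite lerN2; apply: (@phi_nd j) => [i ij|]; rewrite !mxE.
    by rewrite yz.
  by rewrite lerD2l lerN2.
have tr : translation_equivariant (fun y => - phi (x - y)).
  move=> y d; rewrite opprD addrA (_ : - const_mx d = const_mx (- d)).
    by rewrite phi_tr opprD opprK.
  by apply/rowP => i; rewrite !mxE.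
have := measurable_funN (measurable_monotone_equivariant nd tr).
by apply: eq_measurable_fun => t _ /=; rewrite opprK.
Qed.

Let integrable_phi x (g : n.-tuple RM -> R) (C : R) : measurable_fun setT g ->
  (forall t, `|g t| <= C * \1_(@box R n 2) t) ->
  mu.-integrable setT (EFin \o (fun t => phi (x - row_of_tuple t) * g t)).
Proof.
move=> mg gC; apply: (@integrable_box _ _ 2 ((`|phi x| + 2) * C)) => //.
  exact: measurable_funM.
move=> t; rewrite normrM; have := gC t; rewrite indicE.
have [|_] := boolP (t \in _); last first.
  by rewrite !mulr0 normr_le0 => /eqP ->; rewrite normr0 mulr0.
rewrite inE !mulr1 => tb; apply: ler_pM => //.
have : `|phi (x - row_of_tuple t) - phi x| <= 2.
  by apply: monotone_equivariant_dist => // i; rewrite !mxE addrAC subrr add0r normrN.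
by have := ler_normD (phi (x - row_of_tuple t) - phi x) (phi x); rewrite subrK; lra.
Qed.

Let mollE x : mollification phi x = \int[mu]_t (phi (x - row_of_tuple t) * eta t).
Proof. by []. Qed.

Let integrable_moll x :
  mu.-integrable setT (EFin \o (fun t => phi (x - row_of_tuple t) * eta t)).
Proof. exact: integrable_phi eta_box. Qed.

Lemma mollification_nondecreasing : nondecreasing_coord (mollification phi).
Proof.
move=> j x y xy xyj; rewrite !mollE; apply: le_Rintegral => // t _.
rewrite ler_wpM2r//; apply: (@phi_nd j) => [i ij|]; rewrite !mxE.
  by rewrite xy.
by rewrite lerD2r.
Qed.

Lemma mollification_equivariant : translation_equivariant (mollification phi).
Proof.
move=> x d; rewrite !mollE -[d in RHS]mulr1 -integral_eta -RintegralZl//.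
rewrite -RintegralD//; last exact: (integrableZl _ _ integrable_eta).
by apply: eq_Rintegral => t _; rewrite addrAC phi_tr mulrDl.
Qed.

(** The weight [eta] has mass one and vanishes off [box 2], where [phi (x - t)] differs from [phi x]
    by at most 2. *)
Lemma mollification_dist x : `|mollification phi x - phi x| <= 2.
Proof.
rewrite mollE -[phi x]mulr1 -integral_eta -RintegralZl// -RintegralB//; last first.
  exact: (integrableZl _ _ integrable_eta).
apply: (@le_trans _ _ (\int[mu]_t (2 * eta t))); last first.
  by rewrite RintegralZl// integral_eta mulr1.
have intB : mu.-integrable setT (EFin \o
    (fun t => phi (x - row_of_tuple t) * eta t - phi x * eta t)).
  apply: (integrableB _ (integrable_moll x) (integrableZl _ _ integrable_eta)) => //.
apply: (le_trans (le_normr_Rintegral _ intB)) => //.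
apply: le_Rintegral => //.
- exact: integrable_norm.
- exact: (integrableZl _ _ integrable_eta).
move=> t _; rewrite -mulrBl normrM (ger0_norm (eta_ge0 t)).
have := eta_box t; rewrite indicE; have [|_] := boolP (t \in _); last first.
  by rewrite mulr0 normr_le0 => /eqP ->; rewrite !mulr0.
rewrite inE => tb _; rewrite ler_wpM2r//.
by apply: monotone_equivariant_dist => // i; rewrite !mxE addrAC subrr add0r normrN.
Qed.

(* Moving the translation by [a] onto the smooth factor [eta] yields the
   factor [a]; the variation of [phi] yields the factor [d]. *)
Lemma mollification_second_difference : exists C,
  forall (a d : R) (k : 'I_n) x y, 0 <= a <= 1 ->
  (forall i, `|x 0 i - y 0 i| <= d) ->
  `|mollification phi (x + a *: delta_mx 0 k) - mollification phi x -
    (mollification phi (y + a *: delta_mx 0 k) - mollification phi y)| <=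
  C * a * d.
Proof.
(* The factor [40 * c] is the Lipschitz bound for the normalized bump, and [4 ^+ n] is the volume of
   [box 2]. *)
exists (40 * c * 4 ^+ n) => a d k x y a01 xyd.
pose s := shift_tuple (fun i : 'I_n => a *+ (i == k)) : n.-tuple RM -> n.-tuple RM.
pose g t := eta (s t) - eta t.
have mg : measurable_fun setT g.
  apply: measurable_funB => //.
  by apply: (measurableT_comp measurable_eta); exact: measurable_shift_tuple.
have gC t : `|g t| <= 40 * c * a * \1_(@box R n 2) t.
  rewrite /g /eta /mollifier -mulrBr normrM (gtr0_norm c_gt0).
  rewrite (_ : 40 * c * a * _ = c * (40 * a * \1_(@box R n 2) t)); last by ring.
  by rewrite ler_wpM2l ?(ltW c_gt0)//; exact: bump_shift.
(* Substituting [s t] for [t] in the first integral cancels the translation inside [phi]. *)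
have diffE z : mollification phi (z + a *: delta_mx 0 k) - mollification phi z =
    \int[mu]_t (phi (z - row_of_tuple t) * g t).
  rewrite mollE -(RintegralT_shift (fun i : 'I_n => a *+ (i == k)))//.
  rewrite mollE -RintegralB//; last exact: integrable_shift (integrable_moll _).
  apply: eq_Rintegral => t _; rewrite /g mulrBr; congr (phi _ * _ - _).
  apply/rowP => i; rewrite !mxE tnth_mktuple eqxx/= mulr_natr.
  by rewrite opprD addrACA addrAC -!addrA; ring.
rewrite !diffE -RintegralB//; try exact: integrable_phi gC.
have iB : mu.-integrable setT (EFin \o (fun t =>
    phi (x - row_of_tuple t) * g t - phi (y - row_of_tuple t) * g t)).
  by apply: (integrableB _ (integrable_phi x mg gC) (integrable_phi y mg gC)).
apply: (le_trans (le_normr_Rintegral _ iB)) => //.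
have ibox := integrable_indic_box n (ler0n R 2).
have -> : 40 * c * 4 ^+ n * a * d =
    \int[mu]_t (40 * c * a * d * \1_(@box R n 2) t).
  rewrite RintegralZl// RintegralT_box//.
  by rewrite (_ : 2 *+ 2 = 4 :> R); ring.
apply: le_Rintegral => //.
- exact: integrable_norm.
- exact: (integrableZl _ _ ibox).
move=> t _; rewrite -mulrBl normrM.
rewrite (_ : 40 * c * a * d * _ = d * (40 * c * a * \1_(@box R n 2) t)); last by ring.
apply: ler_pM => //.
by apply: monotone_equivariant_dist => // i; rewrite !mxE opprB addrA subrK.
Qed.

Lemma mollification_solution_map (n_ge1 : (1 <= n)%N) : exists K, forall eps x,
  0 < eps < 1 -> `|solution_map phi eps (mollification phi) x -
    mollification phi x| <= eps ^+ 2 * K.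
Proof.
have [C hC] := mollification_second_difference.
(* The 2 bounds the distance from [phi] to its mollification; [n%:R * C] comes from the game value,
   with second differences taken at [a = d = eps]. *)
exists (2 + n%:R * C) => eps x e01; have /andP[e0 e1] := e01.
have e2 : 0 < eps ^+ 2 by rewrite exprn_gt0.
have e21 : eps ^+ 2 < 1 by rewrite expr_lt1// ltW.
have G0 := game_value_ge0 n_ge1 eps (mollification phi) x.
have G1 : game_value eps (mollification phi) x <= n%:R * (C * eps * eps).
  apply: game_value_second_difference => //.
  - exact: mollification_nondecreasing.
  - exact: mollification_equivariant.
  - by move=> k y z yz; apply: hC => //; rewrite !ltW.
have D := mollification_dist x.
rewrite /solution_map /game_step.
set g := game_value _ _ _ in G0 G1 *; set m := mollification phi x in D *.
have -> : eps ^+ 2 * phi x + (1 - eps ^+ 2) * (m + g) - m =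
  eps ^+ 2 * (phi x - m) + (1 - eps ^+ 2) * g by ring.
rewrite [leRHS]mulrDr; apply: (le_trans (ler_normD _ _)); apply: lerD.
  by rewrite normrM gtr0_norm// ler_pM2l// distrC.
rewrite ger0_norm; last by rewrite mulr_ge0//; lra.
rewrite (_ : eps ^+ 2 * _ = n%:R * (C * eps * eps)); last by ring.
by apply: le_trans G1; rewrite ler_piMl//; lra.
Qed.

End payoff.

End mollification.

Unset Implicit Arguments.

Theorem theorem3 (R : realType) (n : nat) (n_ge1 : (1 <= n)%N)
    (phi : 'rV[R]_n -> R) (adm_phi : admissible phi) :
  let solution (eps : R) (u : 'rV[R]_n -> R) :=
    bounded_difference u (mollification phi) /\
    forall x, game_operator phi eps u x = 0 in
  (forall eps : R, 0 < eps < 1 -> exists! u, solution eps u) /\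
  exists M : R, forall (eps : R) (u : 'rV[R]_n -> R),
    0 < eps < 1 -> solution eps u ->
    [/\ forall x, `|u x - mollification phi x| <= M,
        nondecreasing_coord u &
        translation_equivariant u].
Proof.
have [_ phi_nd _ _ phi_tr] := adm_phi.
have [K psiK] := mollification_solution_map phi_nd phi_tr n_ge1.
apply: (approximate_solution_wellposed n_ge1 phi_nd phi_tr _ _ psiK).
- exact: mollification_nondecreasing.
- exact: mollification_equivariant.
Qed.
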